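(* Let $\Sigma$ be a set of equations in a finitary algebraic signature, let $F_\Sigma:\mathrm{Set}\to\mathrm{Set}$ be the associated free-algebra functor, and let $\Sigma'$ be the derivative of $\Sigma$. Then $F_\Sigma$ preserves preimages (equivalently, weakly preserves preimages) if and only if $\Sigma\vdash\Sigma'$.
   Context: Fix a finitary signature. $\Sigma\vdash p\approx q$ means that the equation $p\approx q$ is a consequence of $\Sigma$, i.e. it is derivable in equational logic, equivalently it holds in all nonempty algebras satisfying $\Sigma$; for a set $\Delta$ of equations, $\Sigma\vdash\Delta$ means $\Sigma\vdash\delta$ for all $\delta\in\Delta$. Free-algebra functor: for a set $X$, $F_\Sigma(X)$ is (the underlying set of) the free $\Sigma$-algebra over $X$: terms with variables from $X$, where $p$ and $q$ are identified iff $\Sigma\vdash p\approx q$. For $\varphi:X\to Y$, $F_\Sigma\varphi$ is variable substitution, $p(x_1,\dots,x_n)\mapsto p(\varphi x_1,\dots,\varphi x_n)$. Convention on the empty set: as is standard for Set-functors, the functor is, if necessary, modified on $\emptyset$ and on the maps $\emptyset\to X$ so that it preserves all monos and all finite intersections. Explicitly, $F_\Sigma(\emptyset)$ is the set of those classes of terms $p(x)\in F_\Sigma(\{x\})$ with $\Sigma\vdash p(x)\approx p(y)$ for a variable $y\neq x$, and $F_\Sigma$ sends the map $\emptyset\to X$ with $X\neq\emptyset$ to $p(x)\mapsto p(a)$ for any $a\in X$. (This agrees with the usual $F_\Sigma(\emptyset)$ if the signature has a constant.) Preimages: a pullback of $f_1:A_1\to C$ and $f_2:A_2\to C$ is called a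 preimage if $f_1$ or $f_2$ is mono. A functor (weakly) preserves preimages if it transforms every such pullback diagram into a (weak) pullback diagram. A weak pullback satisfies the existence part, but not necessarily the uniqueness part, of the universal property of a pullback. Derivative: write a term as $p(x,z_1,\dots,z_n)$, $n\ge 0$, to mark its variable occurrences (argument places), into which arbitrary variables can be substituted. The term $p$ is weakly independent of the variable occurrence $x$ (its first marked place) if there are a term $q(y)$ in no variable other than $y$, with $y\neq x$, and (not necessarily distinct) variables $v_1,\dots,v_n$ (possibly equal to $x$ or $y$) such that $\Sigma\vdash p(x,v_1,\dots,v_n)\approx q(y)$. The same definition applies to any other marked place. The derivative $\Sigma'$ of $\Sigma$ is the set of all equations $p(x,z_1,\dots,z_n)\approx p(y,z_1,\dots,z_n)$, with $x,y,z_1,\dots,z_n$ mutually distinct variables, such that $p$ is weakly independent of the marked occurrence $x$. *)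

(* Defs.v *)
From HB Require Import structures.
From mathcomp Require Import all_boot.
From mathcomp Require Import boolp classical_sets.

Set Implicit Arguments.
Unset Strict Implicit.
Unset Printing Implicit Defensive.

Local Open Scope quotient_scope.

(* The category Set is rendered by types and functions, the latter compared
   pointwise. *)
Record set_functor := SetFunctor {
  fobj :> Type -> Type;
  fmap : forall X Y : Type, (X -> Y) -> fobj X -> fobj Y;
  fmap_id : forall X : Type, fmap (@id X) =1 id;
  fmap_comp : forall (X Y Z : Type) (g : Y -> Z) (f : X -> Y),
    fmap (g \o f) =1 fmap g \o fmap f
}.

Arguments fmap _ {X Y} f _.

Definition is_mono (A C : Type) (f : A -> C) : Prop :=
  forall (Q : Type) (g h : Q -> A), f \o g =1 f \o h -> g =1 h.

Definition is_weak_pullback (P A1 A2 C : Type)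
    (p1 : P -> A1) (p2 : P -> A2) (f1 : A1 -> C) (f2 : A2 -> C) : Prop :=
  f1 \o p1 =1 f2 \o p2 /\
  forall (Q : Type) (q1 : Q -> A1) (q2 : Q -> A2), f1 \o q1 =1 f2 \o q2 ->
    exists h : Q -> P, p1 \o h =1 q1 /\ p2 \o h =1 q2.

Definition is_pullback (P A1 A2 C : Type)
    (p1 : P -> A1) (p2 : P -> A2) (f1 : A1 -> C) (f2 : A2 -> C) : Prop :=
  f1 \o p1 =1 f2 \o p2 /\
  forall (Q : Type) (q1 : Q -> A1) (q2 : Q -> A2), f1 \o q1 =1 f2 \o q2 ->
    exists h : Q -> P, [/\ p1 \o h =1 q1, p2 \o h =1 q2 &
      forall h' : Q -> P, p1 \o h' =1 q1 -> p2 \o h' =1 q2 -> h' =1 h].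

Definition is_preimage (P A1 A2 C : Type)
    (p1 : P -> A1) (p2 : P -> A2) (f1 : A1 -> C) (f2 : A2 -> C) : Prop :=
  is_pullback p1 p2 f1 f2 /\ (is_mono f1 \/ is_mono f2).

Definition preserves_preimages (F : set_functor) : Prop :=
  forall (P A1 A2 C : Type)
    (p1 : P -> A1) (p2 : P -> A2) (f1 : A1 -> C) (f2 : A2 -> C),
    is_preimage p1 p2 f1 f2 ->
    is_pullback (fmap F p1) (fmap F p2) (fmap F f1) (fmap F f2).

Definition weakly_preserves_preimages (F : set_functor) : Prop :=
  forall (P A1 A2 C : Type)
    (p1 : P -> A1) (p2 : P -> A2) (f1 : A1 -> C) (f2 : A2 -> C),
    is_preimage p1 p2 f1 f2 ->
    is_weak_pullback (fmap F p1) (fmap F p2) (fmap F f1) (fmap F f2).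

Record signature := Signature { sym : Type; arity : sym -> nat }.

Inductive term (S : signature) (X : Type) : Type :=
  | Var of X
  | App (f : sym S) of ('I_(arity f) -> term S X).

Arguments Var S {X} x.
Arguments App {S X} f ts.

HB.instance Definition _ (S : signature) (X : Type) :=
  gen_eqMixin (term S X).
HB.instance Definition _ (S : signature) (X : Type) :=
  gen_choiceMixin (term S X).

Fixpoint subst (S : signature) (X Y : Type) (s : X -> term S Y)
    (t : term S X) : term S Y :=
  match t with
  | Var x => s x
  | App f ts => App f (fun i => subst s (ts i))
  end.

Definition rename (S : signature) (X Y : Type) (phi : X -> Y) :
    term S X -> term S Y :=
  subst (fun x => Var S (phi x)).

Fixpoint occ (S : signature) (X : eqType) (x : X) (t : term S X) : nat :=
  match t with
  | Var y => y == x
  | App f ts => \sum_(i < arity f) occ x (ts i)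
  end.

Definition equation (S : signature) : Type := term S nat * term S nat.

(* [derives E s t] is derivability within the terms over [X].  For nonempty [X]
   this is the same as derivability with additional variables allowed in the
   intermediate steps, since those can be instantiated by an element of [X];
   below, it is only used for nonempty [X]. *)
Inductive derives (S : signature) (E : set (equation S)) (X : Type) :
    term S X -> term S X -> Prop :=
  | derives_ax (e : equation S) (s : nat -> term S X) :
      E e -> derives E (subst s e.1) (subst s e.2)
  | derives_refl t : derives E t t
  | derives_sym t u : derives E t u -> derives E u t
  | derives_trans t u v : derives E t u -> derives E u v -> derives E t v
  | derives_cong f (ts us : 'I_(arity f) -> term S X) :
      (forall i, derives E (ts i) (us i)) -> derives E (App f ts) (App f us).

Definition entails (S : signature) (E D : set (equation S)) : Prop :=
  forall e : equation S, D e -> derives E e.1 e.2.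

Section FreeFunctor.
Variables (S : signature) (E : set (equation S)).

Definition derivesb (X : Type) : rel (term S X) :=
  fun t u => `[< derives E t u >].

Lemma derivesb_refl X : reflexive (@derivesb X).
Proof. by move=> t; apply/asboolP; exact: derives_refl. Qed.

Lemma derivesb_sym X : symmetric (@derivesb X).
Proof. by move=> t u; apply/asboolP/asboolP; exact: derives_sym. Qed.

Lemma derivesb_trans X : transitive (@derivesb X).
Proof.
move=> u t v /asboolP tu /asboolP uv; apply/asboolP.
exact: derives_trans tu uv.
Qed.

Canonical derives_equiv (X : Type) : equiv_rel (term S X) :=
  EquivRel (@derivesb X) (@derivesb_refl X) (@derivesb_sym X)
    (@derivesb_trans X).

Definition free (X : Type) : Type := {eq_quot derives_equiv X}.

Definition fclass (X : Type) (t : term S X) : free X :=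
  \pi_{eq_quot derives_equiv X} t.

Definition frepr (X : Type) (c : free X) : term S X :=
  repr (c : {eq_quot derives_equiv X}).

Lemma freprK X : cancel (@frepr X) (@fclass X).
Proof. exact: reprK. Qed.

Lemma fclassP X (t u : term S X) : fclass t = fclass u <-> derives E t u.
Proof.
split=> [/eqmodP/asboolP//|tu]; apply/eqmodP; exact/asboolP.
Qed.

Definition free_map (X Y : Type) (phi : X -> Y) (c : free X) : free Y :=
  fclass (rename phi (frepr c)).

(* The usual modification on the empty set, making the functor preserve monos
   and finite intersections: the free algebra on the empty set consists of the
   classes of unary terms [p(x)] with [p(x) = p(y)] derivable; [x] is the element
   of [unit], and the two elements of [bool] serve as the distinct [x] and [y]. *)
Definition pseudo_constant (p : term S unit) : Prop :=
  derives E (rename (fun=> true) p) (rename (fun=> false) p).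

Definition free_empty : Type :=
  {c : free unit | exists2 p, c = fclass p & pseudo_constant p}.

Definition free_obj (X : Type) (dX : {inhabited X} + {~ inhabited X}) : Type :=
  if dX then free X else free_empty.

Definition inh_elt (X : Type) (iX : inhabited X) : X :=
  let: exist x _ := cid (let: inhabits x := iX in ex_intro xpredT x isT) in x.

Lemma inhabited_map (X Y : Type) (phi : X -> Y) : inhabited X -> inhabited Y.
Proof. by case=> x; constructor; exact: phi x. Qed.

Definition free_obj_map (X Y : Type) (phi : X -> Y)
    (dX : {inhabited X} + {~ inhabited X})
    (dY : {inhabited Y} + {~ inhabited Y}) : free_obj dX -> free_obj dY :=
  match dX, dY return free_obj dX -> free_obj dY with
  | left _, left _ => free_map phi
  | left iX, right nY => fun=> False_rect _ (nY (inhabited_map phi iX))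
  | right _, left iY => fun c => free_map (fun=> inh_elt iY) (sval c)
  | right _, right _ => id
  end.

Lemma subst_subst X Y Z (s : X -> term S Y) (r : Y -> term S Z) t :
  subst r (subst s t) = subst (fun x => subst r (s x)) t.
Proof.
by elim: t => //= f ts IH; congr App; apply: funext => i; exact: IH.
Qed.

Lemma rename_comp X Y Z (phi : X -> Y) (psi : Y -> Z) (t : term S X) :
  rename psi (rename phi t) = rename (psi \o phi) t.
Proof. exact: subst_subst. Qed.

Lemma rename_id X (t : term S X) : rename id t = t.
Proof.
by elim: t => //= f ts IH; congr App; apply: funext => i; exact: IH.
Qed.

Lemma derives_subst X Y (s : X -> term S Y) t u :
  derives E t u -> derives E (subst s t) (subst s u).
Proof.
elim=> {t u} [e r Ee|t|t u _ IH|t u v _ IH1 _ IH2|f ts us _ IH] /=.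
- by rewrite !subst_subst; exact: derives_ax.
- exact: derives_refl.
- exact: derives_sym.
- exact: derives_trans IH1 IH2.
- exact: derives_cong.
Qed.

Lemma free_mapE X Y (phi : X -> Y) t :
  free_map phi (fclass t) = fclass (rename phi t).
Proof.
apply/fclassP; apply: derives_subst.
by apply/fclassP; rewrite freprK.
Qed.

Lemma free_map_id X : free_map (@id X) =1 id.
Proof. by move=> c; rewrite /free_map rename_id freprK. Qed.

Lemma free_map_comp X Y Z (g : Y -> Z) (f : X -> Y) :
  free_map (g \o f) =1 free_map g \o free_map f.
Proof.
move=> c; rewrite -[c]freprK; move: (frepr c) => t.
by rewrite /= !free_mapE rename_comp.
Qed.

(* The value at an element of [Y] chosen by [inh_elt] does not matter. *)
Lemma free_map_const Y (a b : Y) (c : free_empty) :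
  free_map (fun=> a) (sval c) = free_map (fun=> b) (sval c).
Proof.
case: c => _ /= [p -> pc]; rewrite !free_mapE; apply/fclassP.
have := derives_subst (fun x : bool => Var S (if x then a else b)) pc.
by rewrite -/(rename _ _) -/(rename _ _) !rename_comp.
Qed.

Definition free_functor_obj (X : Type) : Type :=
  free_obj (pselect (inhabited X)).

Definition free_functor_map (X Y : Type) (phi : X -> Y) :
    free_functor_obj X -> free_functor_obj Y :=
  @free_obj_map X Y phi (pselect (inhabited X)) (pselect (inhabited Y)).

Lemma free_functor_map_id X : free_functor_map (@id X) =1 id.
Proof.
rewrite /free_functor_map /free_functor_obj.
by case: (pselect (inhabited X)) => [iX|nX] //=; exact: free_map_id.
Qed.

Lemma free_functor_map_comp X Y Z (g : Y -> Z) (f : X -> Y) :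
  free_functor_map (g \o f) =1 free_functor_map g \o free_functor_map f.
Proof.
rewrite /free_functor_map /free_functor_obj.
case: (pselect (inhabited X)) => [iX|nX];
  case: (pselect (inhabited Y)) => [iY|nY];
  case: (pselect (inhabited Z)) => [iZ|nZ] //= c;
  try by [case: (nY (inhabited_map f iX))|case: (nZ (inhabited_map g iY))].
- exact: free_map_comp.
- by rewrite -[RHS]free_map_comp; exact: free_map_const.
Qed.

Definition free_functor : set_functor :=
  SetFunctor free_functor_map_id free_functor_map_comp.

End FreeFunctor.

(* A term [p(x_1,...,x_m)] whose variable occurrences are marked is a term over
   the places ['I_m] in which every place occurs exactly once. *)
Definition marked (S : signature) (m : nat) (p : term S 'I_m) : Prop :=
  forall i : 'I_m, occ i p = 1.

(* [v i] is the variable [x] put in the marked place [i]; the other values of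
   [v] are the arbitrary variables put in the remaining places. *)
Definition weakly_independent (S : signature) (E : set (equation S))
    (m : nat) (p : term S 'I_m) (i : 'I_m) : Prop :=
  exists (v : 'I_m -> nat) (y : nat) (q : term S nat),
    [/\ y <> v i, forall w : nat, w <> y -> occ w q = 0 &
        derives E (rename v p) q].

Definition derivative (S : signature) (E : set (equation S)) :
    set (equation S) :=
  fun e => exists (m : nat) (p : term S 'I_m) (i : 'I_m) (z : 'I_m -> nat)
             (y : nat),
    [/\ marked p, weakly_independent E p i,
        injective z, forall j : 'I_m, z j <> y &
        e = (rename z p, rename (fun j => if j == i then y else z j) p)].

(* Main.v *)
Require Import Defs.
From mathcomp Require Import all_boot.
From mathcomp Require Import boolp classical_sets.

(** If [F] weakly preserves preimages and [p(x,v) = q(y)] with [y <> x], then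
    pulling the class of [q] in [F {y}] back along the assignment of variables
    to the places of [p] shows that [p] equals a term without the place [x], so
    [x] can be replaced by any variable.  Conversely, let [t] be a term over
    [A2] whose image under [f2] equals a term over the range of [f1].  Collapse
    that range to one variable and its complement to another one: every place of
    [t] holding an element outside the preimage becomes weakly independent, so
    by the derivative these places can be refilled, one after the other, by an
    element of the preimage (or, if there is none, [t] is pseudo-constant).
    Uniqueness holds because [F] preserves monos. *)

Set Implicit Arguments.
Unset Strict Implicit.
Unset Printing Implicit Defensive.

(** * Variable occurrences and marked places of terms *)

Section Terms.
Variable S : signature.

Lemma occ_rename_inj (X Y : eqType) (phi : X -> Y) (x : X) (t : term S X) :
  injective phi -> occ (phi x) (rename phi t) = occ x t.
Proof.
move=> phi_inj; elim: t => [y|f ts IH] /=; first by rewrite inj_eq.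
by apply: eq_bigr => i _; exact: IH.
Qed.

Lemma occ_rename0 (X : Type) (Y : eqType) (phi : X -> Y) (y : Y)
    (t : term S X) :
  (forall x, phi x <> y) -> occ y (rename phi t) = 0.
Proof.
move=> phiNy; elim: t => [x|f ts IH] /=; first by case: eqP => // /phiNy.
by rewrite big1 // => i _; exact: IH.
Qed.

Lemma eq_rename_occ (X : eqType) (Y : Type) (phi psi : X -> Y)
    (t : term S X) :
  (forall x, occ x t <> 0 -> phi x = psi x) -> rename phi t = rename psi t.
Proof.
elim: t => [x|f ts IH] /= eq_phi.
  by rewrite /rename /= eq_phi // eqxx.
congr App; apply: funext => i; apply: IH => x xi; apply: eq_phi.
by move/eqP; rewrite sum_nat_eq0 => /forallP/(_ i)/eqP.
Qed.

Lemma eq_rename (X Y : Type) (phi psi : X -> Y) (t : term S X) :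
  phi =1 psi -> rename phi t = rename psi t.
Proof. by move=> /funext ->. Qed.

(** This makes arbitrary terms accessible to the derivative, which speaks of marked terms only. By
    induction, the places of [App f ts] form the disjoint union [J] of the places of its
    arguments. *)
Lemma marked_factor (X : Type) (t : term S X) :
  exists (m : nat) (p : term S 'I_m) (theta : 'I_m -> X),
    marked p /\ t = rename theta p.
Proof.
elim: t => [x|f ts IH].
  by exists 1, (Var S ord0), (fun=> x); split => // i; rewrite (ord1 i).
pose m i := sval (cid (IH i)).
pose p i : term S 'I_(m i) := sval (cid (svalP (cid (IH i)))).
pose theta i : 'I_(m i) -> X := sval (cid (svalP (cid (svalP (cid (IH i)))))).
have ts_p i : marked (p i) /\ ts i = rename (theta i) (p i).
  exact: svalP (cid (svalP (cid (svalP (cid (IH i)))))).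
pose J : finType := {i : 'I_(arity f) & 'I_(m i)}.
pose inJ i (j : 'I_(m i)) : 'I_#|J| :=
  enum_rank (Tagged (fun i => 'I_(m i)) j : J).
have inJ_inj i : injective (@inJ i).
  by move=> j k /enum_rank_inj/eqP; rewrite eq_Tagged => /eqP.
exists #|J|, (App f (fun i => rename (@inJ i) (p i))).
pose thetaJ (k : 'I_#|J|) := theta (tag (enum_val k)) (tagged (enum_val k)).
exists thetaJ; split.
  move=> k; rewrite -(enum_valK k); case: (enum_val k) => i j /=.
  (* The place occurs once in the [i]-th argument and, because of its tag, in no other one. *)
  rewrite (bigD1 i) //= (occ_rename_inj j (p i) (@inJ_inj i)).
  rewrite (proj1 (ts_p i)) big1 // => i' neq_i'.
  apply: occ_rename0 => j' /enum_rank_inj e.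
  by move/eqP: neq_i'; apply; case: e.
congr App; apply: funext => i; rewrite (proj2 (ts_p i)).
apply: etrans (esym (rename_comp (@inJ i) thetaJ _)).
by apply: eq_rename => j /=; rewrite /thetaJ /inJ enum_rankK.
Qed.

End Terms.

(** * Refilling weakly independent places *)

Section Derivative.
Variables (S : signature) (E : set (equation S)).

Lemma derives_rename (X Y : Type) (phi : X -> Y) (t u : term S X) :
  derives E t u -> derives E (rename phi t) (rename phi u).
Proof. exact: derives_subst. Qed.

Hypothesis EE' : entails E (derivative E).

(** The claim is a substitution instance of an equation of the derivative in which each place is
    named by its own index. *)
Lemma derivative_replace1 (m : nat) (p : term S 'I_m) (i : 'I_m)
    (Y : Type) (f g : 'I_m -> Y) :
  marked p -> weakly_independent E p i -> (forall j, j != i -> f j = g j) ->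
  derives E (rename f p) (rename g p).
Proof.
move=> p_marked p_indep fg.
(* All indices of places lie below [m], so [m] can serve as the fresh variable. *)
pose e := (rename (fun j : 'I_m => j : nat) p,
           rename (fun j : 'I_m => if j == i then m else j) p).
have /EE'/= : derivative E e.
  exists m, p, i, (fun j : 'I_m => j : nat), m; split => //.
    exact: val_inj.
  by move=> j jm; have := ltn_ord j; rewrite jm ltnn.
(* [insub] fails at the fresh variable [m], which is thus sent to [g i]. *)
pose r k := if insub k is Some j then f j else g i.
move=> /(derives_rename r); rewrite !rename_comp.
set f' := r \o _; set g' := r \o _.
have -> : f' = f by apply: funext => j; rewrite /f' /r /= valK.
suff -> : g' = g by [].
apply: funext => j; rewrite /g' /r /=.
have [->|ji] := eqVneq j i; first by rewrite insubF ?ltnn.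
by rewrite valK fg.
Qed.

(** The places are switched from [f] to [g] one at a time; [h k] has switched those below [k]. *)
Lemma derivative_replace (m : nat) (p : term S 'I_m) (bad : pred 'I_m)
    (Y : Type) (f g : 'I_m -> Y) :
  marked p -> (forall i, bad i -> weakly_independent E p i) ->
  (forall j, ~~ bad j -> f j = g j) -> derives E (rename f p) (rename g p).
Proof.
move=> p_marked p_indep fg.
pose h k (j : 'I_m) := if j < k then g j else f j.
have fh k : k <= m -> derives E (rename f p) (rename (h k) p).
  elim: k => [|k IH] km; first exact: derives_refl.
  apply: derives_trans (IH (ltnW km)) _.
  pose i := Ordinal km.
  have hh j : j != i -> h k j = h k.+1 j.
    by move=> ji; rewrite /h ltnS [j <= k]leq_eqVlt -[val j == k]/(j == i)
      (negbTE ji).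
  have [/p_indep ind_i|good_i] := boolP (bad i).
    exact: derivative_replace1 p_marked ind_i hh.
  rewrite (@eq_rename _ _ _ _ (h k.+1)) => [|j]; first exact: derives_refl.
  have [->|] := eqVneq j i; last exact: hh.
  by rewrite /h /= ltnn ltnSn fg.
have := fh m (leqnn m); rewrite (@eq_rename _ _ _ (h m) g) // => j.
by rewrite /h ltn_ord.
Qed.

(** Once the places of [t] are marked, the hypothesis itself witnesses weak independence: a place
    with a bad variable holds [1], whereas the right-hand term has [0] as its only variable. *)
Lemma derivative_refill (X Y : Type) (good : pred X) (t : term S X)
    (q : term S unit) (f g : X -> Y) :
  derives E (rename (fun x => if good x then 0 else 1) t)
            (rename (fun=> 0) q) ->
  (forall x, good x -> f x = g x) -> derives E (rename f t) (rename g t).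
Proof.
have [m [p [theta [p_marked ->]]]] := marked_factor t.
rewrite !rename_comp => tq fg.
apply: (@derivative_replace _ _ (fun j => ~~ good (theta j))) => //.
  move=> i bad_i; exists (fun j => if good (theta j) then 0 else 1), 0.
  exists (rename (fun=> 0) q); split => //; first by rewrite (negbTE bad_i).
  by move=> w w0; apply: occ_rename0 => _ /esym.
by move=> j /negPn; exact: fg.
Qed.

End Derivative.

(** * Monos and pullbacks in Set *)

Section FreeFunctorPreimages.
Variables (S : signature) (E : set (equation S)).

Lemma mono_inj (A C : Type) (f : A -> C) : is_mono f -> injective f.
Proof.
by move=> f_mono x y fxy; apply: (f_mono unit (fun=> x) (fun=> y) _ tt).
Qed.

Lemma pullback_elt (P A1 A2 C : Type) (p1 : P -> A1) (p2 : P -> A2)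
    (f1 : A1 -> C) (f2 : A2 -> C) :
  is_weak_pullback p1 p2 f1 f2 -> forall a1 a2, f1 a1 = f2 a2 ->
  exists2 x, p1 x = a1 & p2 x = a2.
Proof.
case=> _ pb a1 a2 a12.
have [h [h1 h2]] := pb unit (fun=> a1) (fun=> a2) (fun=> a12).
by exists (h tt); [exact: h1|exact: h2].
Qed.

Lemma pullback_weak (P A1 A2 C : Type) (p1 : P -> A1) (p2 : P -> A2)
    (f1 : A1 -> C) (f2 : A2 -> C) :
  is_pullback p1 p2 f1 f2 -> is_weak_pullback p1 p2 f1 f2.
Proof.
case=> comm pb; split=> // Q q1 q2 q12.
by have [h [h1 h2 _]] := pb Q q1 q2 q12; exists h.
Qed.

Lemma pullback_sym (P A1 A2 C : Type) (p1 : P -> A1) (p2 : P -> A2)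
    (f1 : A1 -> C) (f2 : A2 -> C) :
  is_pullback p1 p2 f1 f2 -> is_pullback p2 p1 f2 f1.
Proof.
case=> comm pb; split=> [x|Q q1 q2 q12]; first by rewrite comm.
have [h [h1 h2 uniq]] := pb Q q2 q1 (fun x => esym (q12 x)).
by exists h; split=> // h' h'1 h'2; exact: uniq.
Qed.

Lemma pullback_mono (P A1 A2 C : Type) (p1 : P -> A1) (p2 : P -> A2)
    (f1 : A1 -> C) (f2 : A2 -> C) :
  is_pullback p1 p2 f1 f2 -> injective f1 -> injective p2.
Proof.
case=> comm pb f1_inj x y xy.
have xy1 : p1 x = p1 y.
  by apply: f1_inj; have /= -> := comm x; have /= -> := comm y; rewrite xy.
have [h [_ _ uniq]] := pb unit (fun=> p1 x) (fun=> p2 x) (fun=> comm x).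
by rewrite (uniq (fun=> x) _ _ tt) // (uniq (fun=> y) _ _ tt).
Qed.

(** * From the derivative to preservation of preimages *)

Lemma free_map_map (X Y Z : Type) (g : Y -> Z) (f : X -> Y) (c : free E X) :
  free_map g (free_map f c) = free_map (g \o f) c.
Proof. by rewrite free_map_comp. Qed.

(** For nonempty [X], a left inverse of [f] induces a left inverse. For empty [X] and nonempty [Y],
    collapsing all variables to [tt] recovers the class. *)
Lemma free_obj_map_inj (X Y : Type) (f : X -> Y)
    (dX : {inhabited X} + {~ inhabited X})
    (dY : {inhabited Y} + {~ inhabited Y}) :
  injective f -> injective (@free_obj_map S E X Y f dX dY).
Proof.
move=> f_inj; case: dX dY => [iX|nX] [iY|nY] //=.
- have x0 := inh_elt iX.
  have /choice[g gK] : forall y, exists x, forall x', f x' = y -> x' = x.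
    move=> y; have [[x <-]|no_x] := pselect (exists x, f x = y).
      by exists x => x' /f_inj.
    by exists x0 => x' fx'; case: no_x; exists x'.
  have : cancel (free_map (E := E) f) (free_map g).
    move=> c; rewrite free_map_map (_ : g \o f = id) ?free_map_id //.
    by apply: funext => x; symmetry; exact: gK.
  exact: can_inj.
- by case: (nY (inhabited_map f iX)).
- move=> c d /(congr1 (free_map (E := E) (fun=> tt))).
  rewrite !free_map_map (_ : _ \o _ = id) ?free_map_id.
    exact: eq_sig_hprop (fun=> @Prop_irrelevance _) _ _.
  by apply: funext; case.
Qed.

(** This gives existence in the [A2] coordinate only; when [f1] is mono, the [A1] coordinate follows
    by cancelling the injective image of [f1]. *)
Lemma free_obj_map_lift (P A1 A2 C : Type) (p2 : P -> A2)
    (f1 : A1 -> C) (f2 : A2 -> C)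
    (dP : {inhabited P} + {~ inhabited P})
    (d1 : {inhabited A1} + {~ inhabited A1})
    (d2 : {inhabited A2} + {~ inhabited A2})
    (dC : {inhabited C} + {~ inhabited C}) :
  entails E (derivative E) ->
  (forall a1 a2, f1 a1 = f2 a2 -> exists x, p2 x = a2) ->
  forall (c1 : free_obj E d1) (c2 : free_obj E d2),
    free_obj_map f1 dC c1 = free_obj_map f2 dC c2 ->
    exists d : free_obj E dP, free_obj_map p2 d2 d = c2.
Proof.
(* If [A2] is empty, so is [P], and the map between the two values is the identity. *)
move=> EE' lift c1; case: d2 => [i2|n2] c2; last first.
  case: dP => [iP|nP] _; first by case: (n2 (inhabited_map p2 iP)).
  by exists c2.
case: dC => [iC|nC]; last by case: (nC (inhabited_map f2 i2)).
rewrite /= -[c2]freprK; move: (frepr c2) => t {c2}.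
pose inU c := `[< exists a1, f1 a1 = c >].
pose g c := if inU c then 0 else 1.
have gf1 a : g (f1 a) = 0.
  by rewrite /g ifT //; apply/asboolP; exists a.
move=> c12; have [q tq] : exists q : term S unit,
    derives E (rename (fun x => if inU (f2 x) then 0 else 1) t)
              (rename (fun=> 0) q).
  case: d1 c1 c12 => [i1|n1] c1 /=.
    rewrite -[c1]freprK !free_mapE => /esym/fclassP/(derives_rename g).
    rewrite !rename_comp => tu.
    exists (rename (fun=> tt) (frepr c1)); rewrite rename_comp.
    by rewrite -(@eq_rename _ _ _ (g \o f1)).
  (* If [A1] is empty, the range of [f1] is empty and [g] is constantly [1]; since [p] is
     pseudo-constant, this [1] can be changed to [0]. *)
  case: c1 => c [p cp pc] /=; rewrite {}cp.
  rewrite !free_mapE => /esym/fclassP/(derives_rename g).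
  rewrite !rename_comp => tp; exists p; apply: derives_trans tp _.
  have -> : g \o (fun=> inh_elt iC) = (fun=> 1) :> (unit -> nat).
    apply: funext => u; rewrite /= /g ifF //; apply/negP => /asboolP[a _].
    by apply: n1.
  have := derives_rename (fun b : bool => if b then 1 else 0) pc.
  by rewrite !rename_comp.
have goodP a : inU (f2 a) -> exists x, p2 x = a.
  by move=> /asboolP[a1 /lift].
case: dP => [iP|nP].
  (* [k] chooses a preimage under [p2] where one is guaranteed and a default elsewhere, so [p2 \o k]
     differs from the identity at bad elements only. *)
  have /choice[k kP] : forall a, exists x, inU (f2 a) -> p2 x = a.
    move=> a; have [/goodP[x <-]|_] := boolP (inU (f2 a)); first by exists x.
    by exists (inh_elt iP).
  exists (fclass E (rename k t)) => /=.
  rewrite free_mapE rename_comp; apply/fclassP.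
  rewrite -[X in derives _ _ X]rename_id.
  exact: (derivative_refill EE' (good := inU \o f2) tq).
(* With [P] empty there are no good elements, so all renamings of [t] into a given type are equal
   modulo [E]. *)
have refill (Y : Type) (f h : A2 -> Y) : derives E (rename f t) (rename h t).
  apply: (derivative_refill EE' (good := inU \o f2) tq) => a /goodP[x _].
  by case: nP.
pose p := rename (fun=> tt) t.
have pc : pseudo_constant E p by rewrite /pseudo_constant !rename_comp.
exists (exist _ (fclass E p) (ex_intro2 _ _ p erefl pc)) => /=.
rewrite free_mapE rename_comp; apply/fclassP.
by rewrite -[X in derives _ _ X]rename_id.
Qed.

Lemma fmap_free_inj (X Y : Type) (f : X -> Y) :
  injective f -> injective (fmap (free_functor E) f).
Proof. exact: free_obj_map_inj. Qed.

Lemma fmap_free_pullback (P A1 A2 C : Type) (p1 : P -> A1) (p2 : P -> A2)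
    (f1 : A1 -> C) (f2 : A2 -> C) :
  entails E (derivative E) -> is_pullback p1 p2 f1 f2 -> is_mono f1 ->
  is_pullback (fmap (free_functor E) p1) (fmap (free_functor E) p2)
              (fmap (free_functor E) f1) (fmap (free_functor E) f2).
Proof.
move=> EE' pb /mono_inj f1_inj; set F := free_functor E.
have Ff1_inj := fmap_free_inj f1_inj.
have Fp2_inj := fmap_free_inj (pullback_mono pb f1_inj).
have Fcomm : fmap F f1 \o fmap F p1 =1 fmap F f2 \o fmap F p2.
  move=> c; rewrite -[LHS]fmap_comp -[RHS]fmap_comp.
  by rewrite (funext (proj1 pb)).
have lift a1 a2 : f1 a1 = f2 a2 -> exists x, p2 x = a2.
  by move=> /(pullback_elt (pullback_weak pb))[x _ <-]; exists x.
split=> // Q q1 q2 q12.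
have /choice[h hP] : forall x, exists d, fmap F p2 d = q2 x.
  by move=> x; apply: free_obj_map_lift EE' lift _ _ (q12 x).
exists h; split=> [x|x|h' _ h'2 x]; last 2 first.
- exact: hP.
- by apply: Fp2_inj; rewrite hP; exact: h'2.
- apply: Ff1_inj; apply: etrans (Fcomm (h x)) _.
  by apply: etrans (congr1 _ (hP x)) _; rewrite -[LHS]q12.
Qed.

Lemma entails_preserves_preimages :
  entails E (derivative E) -> preserves_preimages (free_functor E).
Proof.
move=> EE' P A1 A2 C p1 p2 f1 f2 [pb [mono1|mono2]].
  exact: fmap_free_pullback.
by apply: pullback_sym; apply: fmap_free_pullback => //; exact: pullback_sym.
Qed.

(** * From weak preservation back to the derivative *)

(** The class of [t] comes from [P], where [f] and [g] cannot be told apart; if [P] is empty, it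
    comes from a pseudo-constant. *)
Lemma free_obj_map_avoid (P X Y : Type) (p : P -> X) (f g : X -> Y)
    (dP : {inhabited P} + {~ inhabited P}) (iX : inhabited X)
    (d : free_obj E dP) (t : term S X) :
  (forall x, f (p x) = g (p x)) ->
  free_obj_map p (left iX) d = fclass E t ->
  derives E (rename f t) (rename g t).
Proof.
move=> fg dt; suff : free_map (E := E) f (fclass E t) = free_map (E := E) g (fclass E t).
  by rewrite !free_mapE => /fclassP.
rewrite -dt; case: dP d {dt} => [iP|nP] d /=.
  by rewrite !free_map_map (_ : f \o p = g \o p) //; exact: funext.
by rewrite !free_map_map; exact: free_map_const.
Qed.

Lemma weakly_preserves_entails :
  weakly_preserves_preimages (free_functor E) -> entails E (derivative E).
Proof.
move=> wpp _ [m [p [i [z [y' [_ [v [y [q [yvi q_y vpq]]]] _ _ ->]]]]]] /=.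
(* The preimage under [v] of the point [y]; it misses the place [i]. *)
pose P := {j : 'I_m | v j = y}.
have pre : is_preimage (fun=> tt) (@sval _ _ : P -> 'I_m) (fun=> y) v.
  split; last by left=> Q g h _ x; case: (g x) (h x) => [] [].
  split=> [[j /= ->] //|Q q1 q2 q12].
  exists (fun x => exist _ (q2 x) (esym (q12 x))); split=> // [x|h' _ h'2 x].
    by case: (q1 x).
  by apply: eq_sig_hprop => [j|]; [exact: Prop_irrelevance|exact: h'2].
have := pullback_elt (wpp _ _ _ _ _ _ _ _ pre).
rewrite /= /free_functor_obj /free_functor_map.
case: (pselect (inhabited unit)) => [i1|[]//].
case: (pselect (inhabited 'I_m)) => [iI|[]//].
case: (pselect (inhabited nat)) => [iN|[]]; last by constructor; exact: 0.
(* As [q] has no variable but [y], collapsing it to [tt] and then sending [tt] to [y] restores it.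
   Hence the two classes agree over [nat]. *)
move=> /(_ (fclass E (rename (fun=> tt) q)) (fclass E p))[].
  rewrite /= !free_mapE rename_comp; apply/fclassP/derives_sym.
  rewrite (@eq_rename_occ _ _ _ _ id) ?rename_id // => w qw /=.
  by apply: contra_notP qw => /nesym; exact: q_y.
move=> d _; apply: free_obj_map_avoid => -[j /= vj].
by case: eqP vj => // -> /esym.
Qed.

End FreeFunctorPreimages.

Theorem theorem7 (S : signature) (E : set (equation S)) :
  (preserves_preimages (free_functor E) <-> entails E (derivative E)) /\
  (weakly_preserves_preimages (free_functor E) <-> entails E (derivative E)).
Proof.
have strong_weak : preserves_preimages (free_functor E) ->
    weakly_preserves_preimages (free_functor E).
  by move=> pp P A1 A2 C p1 p2 f1 f2 /pp/pullback_weak.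
split; split.
- by move=> /strong_weak/weakly_preserves_entails.
- exact: entails_preserves_preimages.
- exact: weakly_preserves_entails.
- by move=> /entails_preserves_preimages/strong_weak.
Qed.
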